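(* Let $G>0$, let generators $1,\dots,n$ all have capacity $G$ and cost functions $f_k(g)=s_k\cdot I(g>0)+v_k g$ on $[0,G]$, where $s_k\ge 0$ is the sum of fixed cost and start up cost and $v_k$ is the variable cost, labelled so that $f_1(G)\le\cdots\le f_n(G)$. Let the demand $y$ satisfy $0<y\le (n-2)G$. Then the market power index $M$ is supermodular, i.e. $$M(i\cup j)\ \ge\ M(i)+M(j)\qquad\text{for all } i\ne j,$$ where $M(i)=\sup\{\tilde P_i\}-P_i$ is the maximal additional profit generator $i$ can obtain by strategic bidding alone, and $M(i\cup j)=\sup\{\tilde P_{i\cup j}\}-P_{i\cup j}$ is the maximal additional profit generators $i$ and $j$ can obtain by colluding and bidding strategically together, with all quantities as defined in the context.
   Context: Notation: $I(\cdot)$ is the indicator function, $\{a\}^+=\max\{a,0\}$, $m=\lceil y/G\rceil$ and $x=y-(m-1)G$. Dispatch. Given the cost functions that are bid, the system operator minimizes the total bid cost $\sum_{k=1}^n \tilde f_k(g_k)$ subject to $\sum_{k=1}^n g_k=y$ and $0\le g_k\le G$. It uses an optimal solution in which $m-1$ generators produce $G$, one generator produces $x$, and the remaining $n-m$ produce $0$. Truthful profit. If all generators bid truthfully, generator $i$'s profit (from sales plus uplift payment, under convex hull pricing) is $P_i=\{f_m(G)-f_i(G)\}^+$. For two generators, $P_{i\cup j}=P_i+P_j$. Strategic bidding. Generators cannot withhold capacity or misreport $s_k$. A strategic generator $k$ may only report a different variable cost $\tilde v_k$, i.e. bid $\tilde f_k(g)=s_k I(g>0)+\tilde v_k g$;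 every non-strategic generator bids $\tilde f_k=f_k$. Let $\tilde f^{(1)},\dots,\tilde f^{(n)}$ be the bid cost functions reordered so that $\tilde f^{(1)}(G)\le\cdots\le\tilde f^{(n)}(G)$, and let $\tilde{\mathbf g}^*=(\tilde g_1^*,\dots,\tilde g_n^* )$ be the operator's optimal dispatch for the bid costs. The true total profit of a strategic generator $k$ is $$\tilde P_k=\big\{\tilde f^{(m)}(G)-\tilde f_k(G)\big\}^+ +\big(\tilde f_k(\tilde g_k^* )-f_k(\tilde g_k^* )\big).$$ Single generator. When only generator $i$ is strategic, $\sup\{\tilde P_i\}=\sup_{u\in\{0,x,G\}}\{\tilde P_i\mid \tilde g_i^*=u\}$ is the supremum of $\tilde P_i$ over its possible reports $\tilde v_i$ (and resulting dispatches). Coalition of two. When generators $i$ and $j$ collude and all other generators are truthful, $\tilde P_{i\cup j}=\tilde P_i+\tilde P_j$ is their joint profit, and $\sup\{\tilde P_{i\cup j}\}$ is its supremum over joint reports $(\tilde v_i,\tilde v_j)$ (and resulting dispatches). *)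

(* Defs.v *)
From HB Require Import structures.
From mathcomp Require Import all_boot all_order all_algebra.
From mathcomp Require Import classical_sets reals constructive_ereal ereal.

Set Implicit Arguments.
Unset Strict Implicit.
Unset Printing Implicit Defensive.
Import Order.TTheory GRing.Theory Num.Theory.
Local Open Scope classical_set_scope.
Local Open Scope ring_scope.

Section Market.
Variables (R : realType) (n : nat).
Implicit Types (G y : R) (s v w g : 'I_n -> R) (S : {set 'I_n}).

Definition pos_part (a : R) : R := Num.max a 0.

(** [s I(q > 0) + v q], used only for outputs [q] in [[0, G]]. *)
Definition cost (s v : R) : R -> R := fun q => s * (0 < q)%R%:R + v * q.

(** [absz] only converts to [nat]: the ceiling is positive when
    [0 < y] and [0 < G]. *)
Definition num_units G y : nat := `|Num.ceil (y / G)|%N.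

Definition residual G y : R := y - ((num_units G y)%:R - 1) * G.

Definition costs s v : seq (R -> R) := [seq cost (s k) (v k) | k : 'I_n].

(** The [m]-th function of a list, counted from 1. *)
Definition mth_cost (m : nat) (c : seq (R -> R)) : R -> R :=
  nth (fun=> 0) c m.-1.

Definition reorder_costs G (c : seq (R -> R)) : seq (R -> R) :=
  sort (fun p q : R -> R => p G <= q G) c.

Definition total_cost s v g : R := \sum_(k < n) cost (s k) (v k) (g k).

Definition feasible G y g : Prop :=
  \sum_(k < n) g k = y /\ forall k, 0 <= g k <= G.

Definition optimal_dispatch G y s v g : Prop :=
  feasible G y g /\
  forall h, feasible G y h -> total_cost s v g <= total_cost s v h.

(** [m - 1] generators (the set [A]) produce [G], the generator [k0] produces
    [x], and all the others produce [0]. *)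
Definition extremal_dispatch G y g : Prop :=
  exists (A : {set 'I_n}) (k0 : 'I_n),
    [/\ #|A| = (num_units G y).-1, k0 \notin A &
        forall k, g k = if k \in A then G
                        else if k == k0 then residual G y else 0].

Definition operator_dispatch G y s v g : Prop :=
  optimal_dispatch G y s v g /\ extremal_dispatch G y g.

(** The generators are assumed to be labelled by nondecreasing true cost at
    full capacity, so that [f_m] is read off without reordering. *)
Definition truthful_profit G y s v (k : 'I_n) : R :=
  pos_part (mth_cost (num_units G y) (costs s v) G - cost (s k) (v k) G).

(** [v] are the true variable costs and [w] the reported ones. *)
Definition strategic_profit G y s v w g (k : 'I_n) : R :=
  pos_part (mth_cost (num_units G y) (reorder_costs G (costs s w)) G
            - cost (s k) (w k) G)
  + (cost (s k) (w k) (g k) - cost (s k) (v k) (g k)).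

(** The joint profits attainable by the coalition [S], over all its reports
    and all resulting dispatches (any tie-breaking by the operator). *)
Definition coalition_profits G y s v S : set (\bar R) :=
  [set p | exists w g,
     [/\ forall k, k \notin S -> w k = v k,
         operator_dispatch G y s w g &
         p = (\sum_(k in S) strategic_profit G y s v w g k)%:E]].

(** The market power index [M]; the supremum is taken in the extended reals,
    so that no boundedness is presupposed. *)
Definition market_power G y s v S : \bar R :=
  (ereal_sup (coalition_profits G y s v S)
   - (\sum_(k in S) truthful_profit G y s v k)%:E)%E.

End Market.

(* Main.v *)
(** Swapping the outputs of two or three generators turns a dispatch into
    another one, so an optimal dispatch satisfies exchange inequalities between
    the bids.  They show that a lone bidder [i] either gains at most its
    truthful profit or may be assumed to gain at most [(w_i - v_i) g_i] from
    sales alone, at a report [w_i > v_i].  If both [i] and [j] gain in this way,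
    it mostly suffices that only [j] misreports: its bid raises the price
    [f^(m)(G)], and the uplift payment of the truthful [i] covers what [i]
    gained alone; in one case the report of [j] must first be raised further.
    The exception is that one of them fills the residual demand while the other
    runs at full capacity, and is itself idle in the dispatch where the other
    fills it; then it withdraws by bidding very high.  The truthful profits
    cancel in the market power indices. *)

Require Import Defs.
From HB Require Import structures.
From mathcomp Require Import all_boot all_order all_algebra all_fingroup.
From mathcomp Require Import classical_sets reals constructive_ereal ereal.
From mathcomp Require Import lra ring zify.
Set Implicit Arguments.
Unset Strict Implicit.
Import Order.TTheory GRing.Theory Num.Theory.
Local Open Scope ring_scope.

(** * Bid costs under a changed report and under exchanged outputs *)

Section Cost.
Variables (R : realType) (n : nat).
Implicit Types (s v w g : 'I_n -> R).

Lemma cost0 (a b : R) : cost a b 0 = 0.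
Proof. by rewrite /cost ltxx mulr0 mulr0 addr0. Qed.

Lemma cost_gt0 (a b q : R) : 0 < q -> cost a b q = a + b * q.
Proof. by move=> q0; rewrite /cost q0 mulr1. Qed.

Lemma cost_rebid (a b b' q : R) : cost a b' q = cost a b q + (b' - b) * q.
Proof. rewrite /cost; ring. Qed.

Lemma total_cost_rebid s w w' g (j : 'I_n) :
  (forall k, k != j -> w' k = w k) ->
  total_cost s w' g = total_cost s w g + (w' j - w j) * g j.
Proof.
move=> ww'; rewrite /total_cost (bigD1 j) //= [in RHS](bigD1 j) //=.
under eq_bigr => k kj do rewrite ww' //.
by rewrite (cost_rebid (s j) (w j)); ring.
Qed.

Lemma total_cost_swap s w g (a b : 'I_n) : a != b ->
  total_cost s w (g \o tperm a b) =
  total_cost s w g - cost (s a) (w a) (g a) - cost (s b) (w b) (g b)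
  + cost (s a) (w a) (g b) + cost (s b) (w b) (g a).
Proof.
move=> ab; rewrite /total_cost (bigD1 a) //= (bigD1 b) 1?eq_sym //=.
rewrite [in RHS](bigD1 a) //= [in RHS](bigD1 b) 1?eq_sym //=.
rewrite tpermL tpermR.
under eq_bigr => k /andP[ka kb] do rewrite tpermD 1?eq_sym //.
ring.
Qed.

Lemma total_cost_cycle s w g (a b c : 'I_n) : a != b -> a != c -> b != c ->
  total_cost s w (g \o tperm a b \o tperm b c) =
  total_cost s w g
  - cost (s a) (w a) (g a) - cost (s b) (w b) (g b) - cost (s c) (w c) (g c)
  + cost (s a) (w a) (g b) + cost (s b) (w b) (g c) + cost (s c) (w c) (g a).
Proof.
move=> ab ac bc; rewrite total_cost_swap // total_cost_swap //= tpermR.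
by rewrite (@tpermD _ a b c) //; ring.
Qed.

End Cost.

(** * Number of units and residual demand *)

Section Units.
Variables (R : realType) (G y : R).
Hypotheses (G_gt0 : 0 < G) (y_gt0 : 0 < y).

Lemma num_units_gt0 : (0 < num_units G y)%N.
Proof. by rewrite absz_gt0 gt_eqF // ceil_gt0 divr_gt0. Qed.

Lemma num_unitsE : ((num_units G y)%:R : R) = (Num.ceil (y / G))%:~R.
Proof.
rewrite -[LHS]/(Posz _)%:~R /num_units gez0_abs //.
by rewrite ltW // ceil_gt0 divr_gt0.
Qed.

Lemma residual_itv : 0 < residual G y <= G.
Proof.
rewrite /residual num_unitsE; have := ceil_itv (y / G).
rewrite intrD rmorphN1 ltr_pdivlMr // ler_pdivrMr // => /andP[? ?].
by apply/andP; split; lra.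
Qed.

Lemma residual_gt0 : 0 < residual G y.
Proof. by case/andP: residual_itv. Qed.

Lemma residual_le : residual G y <= G.
Proof. by case/andP: residual_itv. Qed.

Lemma num_units_def (a : nat) (z : R) :
  y = a%:R * G + z -> 0 < z <= G -> num_units G y = a.+1.
Proof.
move=> yE /andP[z0 zG]; rewrite /num_units (@ceil_def _ _ a.+1%:Z) //.
rewrite intrD rmorphN1 ltr_pdivlMr // ler_pdivrMr // yE.
rewrite -[a.+1%:~R]/(a.+1%:R) -natr1.
by apply/andP; split; lra.
Qed.

End Units.

(** * The price as an order statistic of the bids at full capacity *)

Section Price.
Variables (R : realType) (n : nat) (G y : R) (s : 'I_n -> R).
Implicit Types (v w : 'I_n -> R).

Definition full_cost w (k : 'I_n) : R := cost (s k) (w k) G.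

Definition price w : R :=
  mth_cost (num_units G y) (reorder_costs G (costs s w)) G.

Lemma priceE w :
  price w = nth 0 (sort <=%O [seq full_cost w k | k : 'I_n]) (num_units G y).-1.
Proof.
rewrite /price /mth_cost /reorder_costs.
have -> : [seq full_cost w k | k : 'I_n] = [seq f G | f <- costs s w].
  by rewrite -map_comp.
have nthG (c : seq (R -> R)) i :
    nth (fun=> 0) c i G = nth 0 [seq f G | f <- c] i.
  by elim: c i => [|f c IH] [|i] //=.
by rewrite nthG; congr nth; rewrite (sort_map (f := fun f : R -> R => f G)).
Qed.

Lemma count_full_cost w (p : pred R) :
  count p (sort <=%O [seq full_cost w k | k : 'I_n])
  = #|[set k | p (full_cost w k)]|.
Proof. by rewrite count_sort count_map cardsE cardE size_filter enumT. Qed.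

Hypotheses (G_gt0 : 0 < G) (y_gt0 : 0 < y) (m_le : (num_units G y <= n)%N).

(** This lemma and the next two characterise the [m]-th smallest bid by counting bids; the sorted
    list is not looked at afterwards. *)
Lemma price_ge w (t : R) :
  (#|[set k | (full_cost w k < t)%R]| < num_units G y)%N -> t <= price w.
Proof.
move=> lt_m; rewrite priceE; apply: nth_count_ge; first exact: sort_le_sorted.
rewrite (count_full_cost w (fun z => z < t)) size_sort size_map -cardE card_ord.
have := num_units_gt0 G_gt0 y_gt0; lia.
Qed.

Lemma card_lt_price w :
  (#|[set k | (full_cost w k < price w)%R]| < num_units G y)%N.
Proof.
rewrite ltnNge; apply/negP => le_card; have := ltxx (price w).
rewrite [in X in X < _]priceE => /negP; apply; apply: nth_count_lt.
  exact: sort_le_sorted.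
rewrite (count_full_cost w (fun z => z < price w)).
have := num_units_gt0 G_gt0 y_gt0; lia.
Qed.

Lemma card_le_price w :
  (num_units G y <= #|[set k | (full_cost w k <= price w)%R]|)%N.
Proof.
rewrite leqNgt; apply/negP => lt_card; have := ltxx (price w).
rewrite [in X in _ < X]priceE => /negP; apply; apply: nth_count_gt.
  exact: sort_le_sorted.
rewrite (count_full_cost w (fun z => z <= price w)).
rewrite size_sort size_map -cardE card_ord.
have := num_units_gt0 G_gt0 y_gt0; lia.
Qed.


(** Passing from [v] to [w] brings no new bid below [price v], so still fewer than [m] bids lie
    there. *)
Lemma le_price v w :
  (forall k, full_cost w k < price v -> full_cost v k < price v) ->
  price v <= price w.
Proof.
move=> wv; apply: price_ge; apply: leq_ltn_trans (card_lt_price v).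
by apply: subset_leq_card; apply/fintype.subsetP => k; rewrite !inE => /wv.
Qed.

End Price.

(** * Extremal and optimal dispatches *)

Section Dispatch.
Variables (R : realType) (n : nat) (G y : R) (s : 'I_n -> R).
Hypotheses (G_gt0 : 0 < G) (y_gt0 : 0 < y) (s_ge0 : forall k, 0 <= s k).
Implicit Types (w g h e : 'I_n -> R) (p : {set 'I_n} * 'I_n).

Local Notation m := (num_units G y).
Local Notation x := (residual G y).

Let x_gt0 : 0 < x. Proof. exact: residual_gt0. Qed.
Let x_le : x <= G. Proof. exact: residual_le. Qed.
Let m_gt0 : (0 < m)%N. Proof. exact: num_units_gt0. Qed.

(** The pairs [(A, k0)] form a finite type, unlike real-valued dispatches, so a cheapest extremal
    dispatch can be chosen among them. *)
Definition slots p : bool := (#|p.1| == m.-1) && (p.2 \notin p.1).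

Definition slot_dispatch p (k : 'I_n) : R :=
  if k \in p.1 then G else if k == p.2 then x else 0.

Lemma slot_dispatch_extremal p : slots p -> extremal_dispatch G y (slot_dispatch p).
Proof. by case/andP=> /eqP cA kA; exists p.1, p.2. Qed.

Lemma extremal_slots g : extremal_dispatch G y g ->
  exists2 p, slots p & g =1 slot_dispatch p.
Proof. by move=> [A [k0 [cA kA gE]]]; exists (A, k0); rewrite // /slots cA eqxx. Qed.

Lemma extremal_comp_perm g (f : {perm 'I_n}) :
  extremal_dispatch G y g -> extremal_dispatch G y (g \o f).
Proof.
move=> [A [k0 [cA kA gE]]]; exists (f @^-1: A), ((f^-1)%g k0).
split; first by rewrite card_preimset //; apply: perm_inj.
  by rewrite inE permKV.
by move=> k; rewrite /= gE inE (canF_eq (permK f)).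
Qed.

Lemma extremal_val g k : extremal_dispatch G y g ->
  [\/ g k = 0, g k = x | g k = G].
Proof.
move=> [A [k0 [_ _ ->]]].
by case: ifP; [constructor 3|case: ifP; [constructor 2|constructor 1]].
Qed.

Lemma extremal_gt0 g k : extremal_dispatch G y g -> g k != 0 -> x <= g k.
Proof. by move=> /extremal_val-/(_ k)[] ->; rewrite ?eqxx. Qed.

Lemma card_support g : extremal_dispatch G y g -> #|[set k | g k != 0]| = m.
Proof.
move=> [A [k0 [cA kA gE]]].
suff -> : [set k | g k != 0] = k0 |: A by rewrite cardsU1 kA cA; lia.
apply/setP => k; rewrite !inE gE.
have [_|_] := boolP (k \in A); first by rewrite orbT (gt_eqF G_gt0).
by have [_|_] := eqVneq k k0; rewrite ?eqxx // (gt_eqF x_gt0).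
Qed.

Lemma card_at_capacity g : extremal_dispatch G y g -> x < G ->
  #|[set k | g k == G]| = m.-1.
Proof.
move=> [A [k0 [cA kA gE]]] xG; rewrite -cA.
suff -> : [set k | g k == G] = A by [].
apply/setP => k; rewrite !inE gE.
have [_|_] := boolP (k \in A); first by rewrite eqxx.
by have [_|_] := eqVneq k k0; rewrite ?(lt_eqF xG) ?(lt_eqF G_gt0).
Qed.

Lemma residual_unit g : extremal_dispatch G y g -> x < G ->
  exists2 a, g a = x & forall k, g k = x -> k = a.
Proof.
move=> [A [k0 [cA kA gE]]] xG; exists k0; first by rewrite gE (negPf kA) eqxx.
move=> k; rewrite gE; case: ifP => _.
  by move=> Gx; move: xG; rewrite -Gx ltxx.
by case: ifP => [/eqP//|_ x0]; move: x_gt0; rewrite -x0 ltxx.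
Qed.

Lemma extremal_feasible g : extremal_dispatch G y g -> feasible G y g.
Proof.
move=> [A [k0 [cA kA gE]]]; split; last first.
  move=> k; rewrite gE; case: ifP => _; first by rewrite lexx ltW.
  by case: ifP => _; rewrite ?lexx ltW.
rewrite (bigD1 k0) //= gE (negPf kA) eqxx.
rewrite (bigID [pred k | k \in A]) /= [X in _ + (_ + X)]big1 => [|k]; last first.
  by case/andP => kk0 kA'; rewrite gE (negPf kA') (negPf kk0).
rewrite (eq_bigl [pred k | k \in A]) => [|k] /=; last first.
  by case: (altP (k =P k0)) => [->|//]; rewrite (negPf kA).
under eq_bigr => k kA' do rewrite gE kA'.
rewrite sumr_const cA /residual -[G *+ _]mulr_natl -subn1 natrB //; lra.
Qed.

(** Between two generators that are both strictly inside [[0, G]], shifting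
    output to the one with the smaller slope does not increase the cost: a
    concave cost is minimized at the extreme points. *)
Lemma extremal_reduction w h : feasible G y h ->
  exists2 e, extremal_dispatch G y e & total_cost s w e <= total_cost s w h.
Proof.
have [N] := ubnP #|[set k | 0 < h k < G]|; elim: N h => // N IH h leN [sumh itvh].
have [[k [l [kl kin lin]]]|noint] :
    (exists k l, [/\ k != l, 0 < h k < G & 0 < h l < G]) \/
    (forall k l, 0 < h k < G -> 0 < h l < G -> k = l).
  case: (boolP [exists k, [exists l, [&& k != l, 0 < h k < G & 0 < h l < G]]]).
    by move=> /existsP[k /existsP[l /and3P[]]]; left; exists k, l.
  rewrite negb_exists => /forallP noint; right => k l kin lin.
  have := noint k; rewrite negb_exists => /forallP/(_ l).
  by rewrite kin lin !andbT negbK => /eqP.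
- wlog wkl : k l kl kin lin / w k <= w l.
    move=> wl; have [|/ltW] := leP (w k) (w l); first exact: wl.
    by apply: wl => //; rewrite eq_sym.
  (* The largest shift from [l] to [k] within the bounds: it brings [k] to [G] or [l] to [0], so
     fewer generators stay strictly inside. *)
  pose d := Num.min (G - h k) (h l).
  have [hk0 hkG] := andP kin; have [hl0 hlG] := andP lin.
  have d_gt0 : 0 < d by rewrite lt_min subr_gt0 hkG.
  have d_le1 : d <= G - h k by rewrite ge_min lexx.
  have d_le2 : d <= h l by rewrite ge_min lexx orbT.
  pose h' t := if t == k then h k + d else if t == l then h l - d else h t.
  have h'k : h' k = h k + d by rewrite /h' eqxx.
  have h'l : h' l = h l - d by rewrite /h' eq_sym (negPf kl) eqxx.
  have h't t : t != k -> t != l -> h' t = h t.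
    by rewrite /h' => /negPf-> /negPf->.
  case: (IH h') => [||e ext le_e].
  + move: leN; rewrite ltnS; apply: leq_trans; apply: proper_card.
    apply/properP; split.
      apply/fintype.subsetP => t; rewrite !inE.
      have [->|tk] := eqVneq t k; first by rewrite kin.
      have [->|tl] := eqVneq t l; first by rewrite lin.
      by rewrite h't.
    case: (leP (G - h k) (h l)) => cmp.
      exists k; rewrite inE ?kin // h'k /d min_l //.
      by rewrite addrC subrK ltxx andbF.
    exists l; rewrite inE ?lin // h'l /d min_r 1?ltW //.
    by rewrite subrr ltxx.
  + split.
      rewrite -sumh (bigD1 k) //= (bigD1 l) 1?eq_sym //=.
      rewrite [in RHS](bigD1 k) //= [in RHS](bigD1 l) 1?eq_sym //= h'k h'l.
      under eq_bigr => t /andP[tk tl] do rewrite h't //.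
      lra.
    move=> t; have [->|tk] := eqVneq t k; first by rewrite h'k; lra.
    have [->|tl] := eqVneq t l; first by rewrite h'l; lra.
    by rewrite h't.
  + exists e => //; apply: le_trans le_e _; rewrite /total_cost.
    rewrite (bigD1 k) //= (bigD1 l) 1?eq_sym //=.
    rewrite [leRHS](bigD1 k) //= [in leRHS](bigD1 l) 1?eq_sym //= h'k h'l.
    under eq_bigr => t /andP[tk tl] do rewrite h't //.
    rewrite (cost_gt0 _ _ hk0) (cost_gt0 _ _ hl0).
    rewrite (cost_gt0 _ _ (addr_gt0 hk0 d_gt0)).
    have : cost (s l) (w l) (h l - d) <= s l + w l * (h l - d).
      by rewrite /cost lerD2r ler_piMr // lern1 leq_b1.
    have : w k * d <= w l * d by rewrite ler_wpM2r // ltW.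
    lra.
(* At most one generator is strictly inside, so [h] itself is extremal. If none is, some generator
   at [G] serves as [k0], and then [x = G]. *)
- have [k0 hk0G hk] : exists2 k0, 0 < h k0 <= G &
      forall k, k != k0 -> h k = 0 \/ h k = G.
    have hval k : [\/ 0 < h k < G, h k = 0 | h k = G].
      have := itvh k; rewrite !le_eqVlt => /andP[/orP[/eqP <-|hk0]].
        by constructor 2.
      by move=> /orP[/eqP ->|hkG]; [constructor 3|constructor 1; rewrite hk0].
    have [k0 kin|none] := pickP [pred k | 0 < h k < G].
      have /andP[hk0 hkG] := kin; exists k0; first by rewrite hk0 ltW.
      move=> k kk0; have [kin'|->|->] := hval k; [|by left|by right].
      by move: kk0; rewrite (noint _ _ kin' kin) eqxx.
    have {hval} hval k : h k = 0 \/ h k = G.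
      by have [kin|->|->] := hval k; [have := none k; rewrite /= kin|left|right].
    have [k0 /eqP hk0|zero] := pickP [pred k | h k == G].
      by exists k0; rewrite ?hk0 ?G_gt0 ?lexx.
    move: y_gt0; rewrite -sumh big1 ?ltxx // => k _.
    by have [//|hkG] := hval k; have := zero k; rewrite /= hkG eqxx.
  pose A := [set k | (h k == G) && (k != k0)].
  have kA : k0 \notin A by rewrite inE eqxx andbF.
  have hE k : h k = if k \in A then G else if k == k0 then h k0 else 0.
    rewrite inE; have [->|kk0] := eqVneq k k0; first by rewrite andbF.
    by have [->|->] := hk k kk0; rewrite ?eqxx // lt_eqF.
  have yE : y = #|A|%:R * G + h k0.
    rewrite -sumh (bigD1 k0) //= addrC; congr (_ + _).
    under eq_bigr => k kk0 do rewrite hE (negPf kk0).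
    rewrite -big_mkcondr /= (eq_bigl [pred k | k \in A]) => [|k] /=; last first.
      by rewrite inE; case: (k != k0); rewrite ?andbF ?andbT.
    by rewrite sumr_const mulr_natl.
  have mE := num_units_def G_gt0 yE hk0G.
  have xE : x = h k0 by rewrite /residual mE -natr1 [in LHS]yE; lra.
  by exists h => //; exists A, k0; split; rewrite ?mE ?xE.
Qed.

Lemma operator_dispatch_extremal w g : extremal_dispatch G y g ->
  (forall e, extremal_dispatch G y e -> total_cost s w g <= total_cost s w e) ->
  operator_dispatch G y s w g.
Proof.
move=> ext min; split => //; split; first exact: extremal_feasible.
by move=> h /(extremal_reduction w)[e /min le_e]; apply: le_trans.
Qed.

Lemma min_extremal w (P : pred ('I_n -> R)) :
  (forall g h, g =1 h -> P g = P h) ->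
  (exists2 g, extremal_dispatch G y g & P g) ->
  exists g, [/\ extremal_dispatch G y g, P g &
    forall e, extremal_dispatch G y e -> P e ->
      total_cost s w g <= total_cost s w e].
Proof.
move=> Pext [g /extremal_slots[p sp gp] Pg].
pose Q q := slots q && P (slot_dispatch q).
have Qp : Q p by rewrite /Q sp -(Pext _ _ gp).
case: (arg_minP (P := Q) (fun q => total_cost s w (slot_dispatch q)) Qp).
move=> q /andP[sq Pq] minq; exists (slot_dispatch q); split=> //.
  exact: slot_dispatch_extremal.
move=> e /extremal_slots[r sr er] Pe.
have -> : total_cost s w e = total_cost s w (slot_dispatch r).
  by apply: eq_bigr => k _; rewrite er.
by apply: minq; rewrite /Q sr -(Pext _ _ er).
Qed.

(** [m < n] leaves at least [m] generators besides [i]. The dispatch found is the operator's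
    fallback when [i] bids too high. *)
Lemma min_extremal_without (i : 'I_n) w : (m < n)%N ->
  exists g, [/\ extremal_dispatch G y g, g i = 0 &
    forall e, extremal_dispatch G y e -> e i = 0 ->
      total_cost s w g <= total_cost s w e].
Proof.
move=> mn; have [||g [ext /eqP gi min]] := @min_extremal w (fun g => g i == 0).
- by move=> g h ->.
- have : (m <= #|[set~ i]|)%N by rewrite cardsC1 card_ord; lia.
  case/card_geqP => t [ut st ti].
  case: t => [|k0 t] in ut st ti *; first by move: m_gt0; rewrite -st.
  have [k0t ut'] := andP ut.
  exists (slot_dispatch ([set k in t], k0)).
    apply: slot_dispatch_extremal; rewrite /slots /= inE k0t andbT.
    by rewrite cardsE (card_uniqP ut') -st.
  have it : i \notin k0 :: t by apply/negP => /ti; rewrite !inE eqxx.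
  move: it; rewrite /slot_dispatch !inE negb_or => /andP[/negPf-> /negPf->].
  by rewrite eqxx.
- by exists g; split=> // e ee /eqP; apply: min.
Qed.

Lemma operator_dispatch_exists w : (m < n)%N ->
  exists g, operator_dispatch G y s w g.
Proof.
move=> mn; have n_gt0 : (0 < n)%N by lia.
have [g0 [ext0 _ _]] := min_extremal_without (Ordinal n_gt0) w mn.
have [//||g [ext _ min]] := @min_extremal w xpredT; first by exists g0.
by exists g; apply: operator_dispatch_extremal => // e /min; apply.
Qed.

Lemma operator_dispatch_le w g e : operator_dispatch G y s w g ->
  extremal_dispatch G y e -> total_cost s w e <= total_cost s w g ->
  operator_dispatch G y s w e.
Proof.
move=> [[_ min] _] ext le_e; apply: operator_dispatch_extremal => // h exth.
by apply: le_trans le_e _; apply: min; apply: extremal_feasible.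
Qed.

(** * Exchange inequalities at an optimal dispatch *)

Section Optimal.
Variables (w g : 'I_n -> R).
Hypothesis opt : operator_dispatch G y s w g.

Lemma operator_dispatch_min e : extremal_dispatch G y e ->
  total_cost s w g <= total_cost s w e.
Proof. by move=> ext; case: opt => -[_ min] _; apply: min; apply: extremal_feasible. Qed.

Lemma swap_le a b : a != b ->
  cost (s a) (w a) (g a) + cost (s b) (w b) (g b) <=
  cost (s a) (w a) (g b) + cost (s b) (w b) (g a).
Proof.
move=> ab; have := operator_dispatch_min (extremal_comp_perm (tperm a b) opt.2).
rewrite total_cost_swap //; lra.
Qed.

Lemma cycle_le a b c : a != b -> a != c -> b != c ->
  cost (s a) (w a) (g a) + cost (s b) (w b) (g b) + cost (s c) (w c) (g c) <=
  cost (s a) (w a) (g b) + cost (s b) (w b) (g c) + cost (s c) (w c) (g a).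
Proof.
move=> ab ac bc; have := operator_dispatch_min
  (extremal_comp_perm (tperm b c) (extremal_comp_perm (tperm a b) opt.2)).
rewrite total_cost_cycle //; lra.
Qed.

Lemma idle_full_cost a b : g a = 0 -> g b = G ->
  full_cost G s w b <= full_cost G s w a.
Proof.
move=> ga gb; have ab : a != b.
  by apply/eqP => ab; move: G_gt0; rewrite -gb -ab ga ltxx.
by have := swap_le ab; rewrite ga gb !cost0 /full_cost; lra.
Qed.

End Optimal.

End Dispatch.

(** * Reports of a single strategic generator *)

Section Bidding.
Variables (R : realType) (n : nat) (G y : R) (s v : 'I_n -> R).
Hypotheses (G_gt0 : 0 < G) (y_gt0 : 0 < y) (s_ge0 : forall k, 0 <= s k).
Hypothesis m_lt : (num_units G y < n)%N.
Implicit Types (w g h e : 'I_n -> R) (i j k : 'I_n).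

Local Notation m := (num_units G y).
Local Notation x := (residual G y).
Local Notation F := (full_cost G s).
Local Notation price := (price G y s).
Local Notation op := (operator_dispatch G y s).
Local Notation profit := (strategic_profit G y s v).

Let x_gt0 : 0 < x. Proof. exact: residual_gt0. Qed.
Let x_le : x <= G. Proof. exact: residual_le. Qed.
Let m_gt0 : (0 < m)%N. Proof. exact: num_units_gt0. Qed.
Let m_le : (m <= n)%N. Proof. exact: ltnW. Qed.

Lemma pos_part_ge0 (a : R) : 0 <= pos_part a.
Proof. by rewrite /pos_part le_max lexx orbT. Qed.

Lemma pos_part_ge (a : R) : a <= pos_part a.
Proof. by rewrite /pos_part le_max lexx. Qed.

Lemma full_costE w k : F w k = s k + w k * G.
Proof. exact: cost_gt0. Qed.

Lemma profitE w g k :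
  profit w g k = pos_part (price w - F w k) + (w k - v k) * g k.
Proof.
rewrite /strategic_profit (cost_rebid _ (v k) (w k) (g k)).
by rewrite [X in _ + X = _]addrAC subrr add0r.
Qed.

Lemma card_lt_units (A : {set 'I_n}) g i :
  extremal_dispatch G y g -> g i != 0 ->
  (forall k, k \in A -> k != i /\ g k != 0) -> (#|A| < m)%N.
Proof.
move=> ext gi gA; rewrite -(card_support G_gt0 y_gt0 ext); apply: proper_card.
apply/properP; split; first by apply/fintype.subsetP => k /gA[]; rewrite inE.
by exists i; rewrite ?inE //; apply/negP => /gA[]; rewrite eqxx.
Qed.

(** A lower bid at capacity belongs to a running generator, since an idle one would replace [i];
    besides [i] fewer than [m] run. *)
Lemma full_cost_le_price w g i : op w g -> g i = G -> F w i <= price w.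
Proof.
move=> opt gi; apply: price_ge => //; apply: (card_lt_units (g := g) (i := i)).
- exact: opt.2.
- by rewrite gi gt_eqF.
- move=> k; rewrite inE => Fk; split.
    by apply: contraTneq Fk => ->; rewrite ltxx.
  apply: contraTneq Fk => gk; rewrite -leNgt.
  exact: (idle_full_cost G_gt0 y_gt0 opt).
Qed.

(** [m - 1] generators at [G] bid at most [F w i]; together with [i] these are [m] bids, which
    cannot all lie below the price. *)
Lemma price_le_idle w g i : op w g -> g i = 0 -> price w <= F w i.
Proof.
move=> opt gi; have [A [k0 [cA kA gE]]] := opt.2; rewrite leNgt; apply/negP => Fi.
have gA k : k \in A -> g k = G by move=> kA'; rewrite gE kA'.
have iA : i \notin A by apply/negP => /gA; rewrite gi => /eqP; rewrite lt_eqF.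
have := card_lt_price s G_gt0 y_gt0 m_le w; rewrite ltnNge => /negP; apply.
have -> : m = #|i |: A| by rewrite cardsU1 iA cA; lia.
apply: subset_leq_card; apply/fintype.subsetP => k; rewrite !inE.
move=> /orP[/eqP->//|/gA gk]; apply: le_lt_trans Fi.
exact: (idle_full_cost G_gt0 y_gt0 opt).
Qed.

Definition agree_off i w := forall k, k != i -> w k = v k.

Lemma full_cost_agree i w k : agree_off i w -> k != i -> F w k = F v k.
Proof. by move=> wv ki; rewrite !full_costE wv. Qed.

Lemma agree_mono i w k : agree_off i w -> v i < w i -> v k <= w k.
Proof. by move=> wv /ltW vw; have [->//|/wv->] := eqVneq k i. Qed.

Lemma price_lowered i w : agree_off i w -> F w i < price w -> price w <= price v.
Proof.
move=> wv Fi; apply: le_price => // k; have [->//|ki] := eqVneq k i.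
by rewrite (full_cost_agree wv).
Qed.

Lemma price_raised i w : agree_off i w -> v i < w i -> price v <= price w.
Proof.
move=> wv vw; apply: le_price => // k; apply: le_lt_trans.
by rewrite !full_costE lerD2l ler_wpM2r ?(ltW G_gt0) ?(agree_mono _ wv).
Qed.

(** The form to which a profitable lone report is reduced: sales alone, without uplift payment,
    bring at least [p]. *)
Definition raised i (p : R) w g :=
  [/\ agree_off i w, v i < w i, op w g, 0 < g i & p <= (w i - v i) * g i].

Definition rebid w j (b : R) k := if k == j then b else w k.

Lemma rebid_same w j b : rebid w j b j = b.
Proof. by rewrite /rebid eqxx. Qed.

Lemma rebid_other w j b k : k != j -> rebid w j b k = w k.
Proof. by rewrite /rebid => /negPf->. Qed.

Lemma total_cost_rebidE w j b g :
  total_cost s (rebid w j b) g = total_cost s w g + (b - w j) * g j.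
Proof.
rewrite (@total_cost_rebid _ _ s w _ g j) ?rebid_same // => k.
exact: rebid_other.
Qed.

(** [i] raises its report until dropping it becomes equally cheap. *)
Lemma raise_residual i w g :
  agree_off i w -> op w g -> g i = x -> F w i < price w ->
  exists w', [/\ agree_off i w', op w' g &
    price w - F w i + (w i - v i) * x <= (w' i - v i) * x].
Proof.
move=> wv opt gi Fi.
have [g0 [ext0 g0i min0]] := min_extremal_without s G_gt0 y_gt0 i w m_lt.
pose d := (total_cost s w g0 - total_cost s w g) / x.
have d_ge0 : 0 <= d.
  rewrite divr_ge0 ?(ltW x_gt0) // subr_ge0.
  exact: (operator_dispatch_min G_gt0 y_gt0 opt).
exists (rebid w i (w i + d)); split.
- by move=> k ki; rewrite rebid_other // wv.
- apply: operator_dispatch_extremal => //; first exact: opt.2.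
  (* A dispatch running [i] gives it at least [x], so it becomes dearer by at least [d * x], as [g]
     does; one without [i] costs no less than [g0], which now ties with [g]. *)
  move=> e exte; rewrite !total_cost_rebidE addrAC subrr add0r gi.
  have [ei|ei] := eqVneq (e i) 0.
    by rewrite ei divfK ?gt_eqF // mulr0 addr0 addrC subrK; apply: min0.
  apply: lerD; first exact: (operator_dispatch_min G_gt0 y_gt0 opt).
  by rewrite ler_wpM2l // extremal_gt0.
- rewrite rebid_same.
  suff : price w - F w i <= d * x by lra.
  rewrite divfK ?gt_eqF //.
  (* The raise must cover the lost uplift. Of the [m] generators in [i |: A], some [a] in [A] bids
     at least the price; replacing [a] by [i] in [g0] cannot undercut [g], so [g0] exceeds [g] by at
     least [price w - F w i]. *)
  have [A [k0 [cA kA gE]]] := ext0.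
  have iA : i \notin A.
    by apply/negP => iA; move: g0i; rewrite gE iA => /eqP; rewrite gt_eqF.
  have [a aA Fa] : exists2 a, a \in A & price w <= F w a.
    have /fintype.subsetPn[a] : ~~ (i |: A \subset [set k | (F w k < price w)%R]).
      apply/negP => /subset_leq_card; rewrite cardsU1 iA cA.
      have := card_lt_price s G_gt0 y_gt0 m_le w; lia.
    rewrite !inE -leNgt => /orP[/eqP->|]; first by rewrite leNgt Fi.
    by exists a.
  have ai : a != i by apply: contraNneq iA => <-.
  have := operator_dispatch_min G_gt0 y_gt0 opt
    (extremal_comp_perm (tperm a i) ext0).
  rewrite total_cost_swap // g0i !cost0 gE aA.
  move: Fa; rewrite /full_cost; lra.
Qed.

Lemma single_cases i w g : agree_off i w -> op w g ->
  profit w g i <= pos_part (price v - F v i) \/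
  exists w' g', raised i (profit w g i) w' g'.
Proof.
move=> wv opt.
have [p_le0|p_gt0] := leP (profit w g i) 0.
  by left; apply: le_trans p_le0 (pos_part_ge0 _).
move: p_gt0; rewrite profitE.
have raisedI w' g' p : agree_off i w' -> op w' g' -> 0 < p ->
    p <= (w' i - v i) * g' i -> raised i p w' g'.
  move=> wv' opt' p0 le_p; have := lt_le_trans p0 le_p.
  have := opt'.1.1.2 i => /andP[g0 _]; move: (g0); rewrite le_eqVlt.
  move=> /orP[/eqP<-|g0']; first by rewrite mulr0 ltxx.
  by rewrite pmulr_lgt0 // subr_gt0.
have [le_F|lt_F] := leP (price w) (F w i).
  rewrite /pos_part max_r ?subr_le0 // add0r => p0.
  by right; exists w, g; apply: raisedI.
rewrite [pos_part (_ - F w i)]/pos_part max_l ?subr_ge0 ?(ltW lt_F) // => p0.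
have le_pv := price_lowered wv lt_F.
(* [price w - F w i + (w i - v i) * G] is [price w - F v i], and [price w] is at most the truthful
   price. *)
have leP0 : (w i - v i) * g i <= (w i - v i) * G ->
    price w - F w i + (w i - v i) * g i <= pos_part (price v - F v i).
  move=> le_gG; apply: (le_trans _ (pos_part_ge _)).
  by rewrite !full_costE; lra.
have [gi|gi|gi] := extremal_val i opt.2.
- by have := price_le_idle opt gi; rewrite leNgt lt_F.
- have [le_vw|lt_wv] := leP (v i) (w i).
    by left; apply: leP0; rewrite ler_wpM2l ?subr_ge0 // gi.
  (* Underbidding loses on only [x] units but earns uplift on [G]; such a gain is converted into
     sales at a higher report. *)
  right; have [w' [wv' opt' le_p]] := raise_residual wv opt gi lt_F.
  by exists w', g; apply: raisedI; rewrite // gi.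
- by left; apply: leP0; rewrite gi.
Qed.

End Bidding.

(** * Joint reports of two generators *)

Section Coalition.
Variables (R : realType) (n : nat) (G y : R) (s v : 'I_n -> R).
Hypotheses (G_gt0 : 0 < G) (y_gt0 : 0 < y) (s_ge0 : forall k, 0 <= s k).
Hypothesis m_lt : (num_units G y < n)%N.
Implicit Types (w g h e : 'I_n -> R) (i j k : 'I_n).

Local Notation m := (num_units G y).
Local Notation x := (residual G y).
Local Notation F := (full_cost G s).
Local Notation price := (price G y s).
Local Notation op := (operator_dispatch G y s).
Local Notation profit := (strategic_profit G y s v).
Local Notation agree_off := (agree_off v).
Local Notation raised := (raised G y s v).

Let x_gt0 : 0 < x. Proof. exact: residual_gt0. Qed.
Let x_le : x <= G. Proof. exact: residual_le. Qed.
Let m_le : (m <= n)%N. Proof. exact: ltnW. Qed.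

Definition attainable i j (t : R) := exists w g,
  [/\ forall k, k \notin [set i; j] -> w k = v k, op w g &
      t <= profit w g i + profit w g j].

Lemma attainable_sym i j t : attainable i j t -> attainable j i t.
Proof.
move=> [w [g [wv opt le_t]]]; exists w, g; split=> //; last by rewrite addrC.
by move=> k kji; apply: wv; rewrite finset.setUC.
Qed.

Lemma attainable_one_report i j w g t : i != j -> agree_off j w -> op w g ->
  t <= (w j - v j) * g j + pos_part (price w - F v i) -> attainable i j t.
Proof.
move=> ij wv opt le_t; exists w, g; split=> //.
  by move=> k; rewrite !inE negb_or => /andP[_ /wv].
apply: le_trans le_t _; rewrite !profitE.
rewrite (full_cost_agree s G_gt0 wv ij) (wv _ ij) subrr mul0r.
have := pos_part_ge0 (price w - F w j); lra.
Qed.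

Lemma attainable_truthful i j : i != j ->
  attainable i j (pos_part (price v - F v i) + pos_part (price v - F v j)).
Proof.
move=> ij; have [g opt] := operator_dispatch_exists G_gt0 y_gt0 s_ge0 v m_lt.
by exists v, g; split=> //; rewrite !profitE !subrr !mul0r; lra.
Qed.

Lemma attainable_one_raised i j q w h : i != j -> raised j q w h ->
  attainable i j (pos_part (price v - F v i) + q).
Proof.
move=> ij [wv vw opt _ le_q]; apply: (attainable_one_report ij wv opt).
have le_price := price_raised s G_gt0 y_gt0 m_lt wv vw.
rewrite addrC lerD // /pos_part ge_max !le_max lexx orbT andbT.
by rewrite lerD2r le_price.
Qed.

Lemma withdraw_exists i w : exists c e, op (rebid w i c) e /\ e i = 0.
Proof.
have [e [exte ei min]] := min_extremal_without s G_gt0 y_gt0 i w m_lt.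
(* Each [d q] is at most their sum, and a running [i] produces at least [x]; adding [c] to its
   report thus outweighs every cost advantage over [e]. *)
pose d q := `|total_cost s w e - total_cost s w (slot_dispatch G y q)|.
pose c := (\sum_(q : {set 'I_n} * 'I_n) d q) / x.
exists (w i + c), e; split=> //; apply: operator_dispatch_extremal => //.
move=> f extf; rewrite !total_cost_rebidE ei mulr0 addr0 addrAC subrr add0r.
have [fi|fi] := eqVneq (f i) 0; first by rewrite fi mulr0 addr0 min.
have [q _ fq] := extremal_slots extf.
have le_dq : d q <= \sum_q d q.
  by rewrite (bigD1 q) //= lerDl sumr_ge0 // => ? _; apply: normr_ge0.
have : total_cost s w e - total_cost s w f <= d q.
  rewrite (_ : total_cost s w f = total_cost s w (slot_dispatch G y q)).
    exact: ler_norm.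
  by apply: eq_bigr => k _; rewrite fq.
have : \sum_q d q <= c * f i.
  rewrite -[leLHS](divfK (_ : x != 0)) ?gt_eqF //.
  rewrite ler_wpM2l ?(extremal_gt0 G_gt0 y_gt0 extf) //.
  by rewrite divr_ge0 ?(ltW x_gt0) // sumr_ge0 // => ? _; apply: normr_ge0.
lra.
Qed.

(** * Both generators gain from sales at raised reports *)

Section TwoRaised.
Variables (i j : 'I_n) (p q : R) (u g w h : 'I_n -> R).
Hypotheses (ij : i != j) (raised_i : raised i p u g) (raised_j : raised j q w h).

Let uv : agree_off i u. Proof. by case: raised_i. Qed.
Let wv : agree_off j w. Proof. by case: raised_j. Qed.
Let opg : op u g. Proof. by case: raised_i. Qed.
Let oph : op w h. Proof. by case: raised_j. Qed.
Let vu : v i < u i. Proof. by case: raised_i. Qed.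
Let vw : v j < w j. Proof. by case: raised_j. Qed.
Let le_p : p <= (u i - v i) * g i. Proof. by case: raised_i. Qed.
Let le_q : q <= (w j - v j) * h j. Proof. by case: raised_j. Qed.

(** The bid of [j] keeps the price at or above [F u i], so the uplift of the truthful [i] is at
    least [(u i - v i) * G]. *)
Lemma attainable_capacity : g i = G -> h j = G -> F u i <= F w j ->
  attainable i j (p + q).
Proof.
move=> gi hj le_F; apply: (attainable_one_report ij wv oph).
have := full_cost_le_price G_gt0 y_gt0 m_lt oph hj.
have := pos_part_ge (price w - F v i).
by move: le_F le_p le_q; rewrite gi hj !full_costE //; lra.
Qed.


Hypothesis xG : x < G.

Let extg : extremal_dispatch G y g. Proof. exact: opg.2. Qed.
Let exth : extremal_dispatch G y h. Proof. exact: oph.2. Qed.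
Let FE := full_costE s G_gt0.
Let cG (a b : R) : cost a b G = a + b * G. Proof. exact: cost_gt0. Qed.
Let cx (a b : R) : cost a b x = a + b * x. Proof. exact: cost_gt0. Qed.
Let ux_gt : v i * x < u i * x. Proof. by rewrite ltr_pM2r. Qed.
Let wx_gt : v j * x < w j * x. Proof. by rewrite ltr_pM2r. Qed.

Lemma attainable_capacity_residual : g i = G -> h j = x -> attainable i j (p + q).
Proof.
move=> gi hj; have [le_F|lt_F] := leP (F u i) (price w).
  apply: (attainable_one_report ij wv oph).
  have := pos_part_ge (price w - F v i).
  by move: le_F le_p le_q; rewrite gi !FE; lra.
(* Lone [i] outbids the price under [w], which forces the generators at or
   below that price to be exactly those running in [g]. *)
pose U := [set k | (F w k <= price w)%R].
have vU k : k \in U -> k != i -> F u k < F u i.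
  rewrite inE => Uk ki; apply: le_lt_trans lt_F; apply: le_trans Uk.
  rewrite (full_cost_agree s G_gt0 uv ki) !FE lerD2l ler_wpM2r ?(ltW G_gt0) //.
  exact: agree_mono wv vw.
have gU k : k \in U -> g k != 0.
  have [->|ki] := eqVneq k i; first by rewrite gi gt_eqF.
  move=> Uk; apply: contraTneq (vU k Uk ki) => gk.
  by rewrite -leNgt (idle_full_cost G_gt0 y_gt0 opg).
have cU : #|U| = m.
  apply/eqP; rewrite eqn_leq (card_le_price s G_gt0 y_gt0 m_le w) andbT.
  rewrite -(card_support G_gt0 y_gt0 extg); apply: subset_leq_card.
  by apply/fintype.subsetP => k /gU; rewrite inE.
(* [U] and the set of running generators both have [m] elements, so a runner outside [U] leaves a
   member of [U] idle; [outU] is the mirror image. *)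
have inU e k : extremal_dispatch G y e -> k \notin U -> e k != 0 ->
    exists2 r, r \in U & e r = 0.
  move=> ext kU ek; case: (pickP [pred r in U | e r == 0]) => [r|none].
    by move=> /andP[? /eqP ?]; exists r.
  have eqU : U == [set k | e k != 0].
    rewrite eqEcard cU (card_support G_gt0 y_gt0 ext) leqnn andbT.
    by apply/fintype.subsetP => l Ul; have := none l; rewrite /= Ul inE => /negbT.
  by move: kU; rewrite (eqP eqU) inE ek.
have outU e k : extremal_dispatch G y e -> k \in U -> e k = 0 ->
    exists2 r, r \notin U & e r != 0.
  move=> ext kU ek; case: (pickP [pred r | (r \notin U) && (e r != 0)]) => [r|none].
    by move=> /andP[? ?]; exists r.
  have eqU : [set k | e k != 0] == U.
    rewrite eqEcard cU (card_support G_gt0 y_gt0 ext) leqnn andbT.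
    apply/fintype.subsetP => l; rewrite inE => el; apply/negPn/negP => Ul.
    by have := none l; rewrite /= Ul el.
  by move: kU; rewrite -(eqP eqU) inE ek eqxx.
have Ug k : g k != 0 -> k \in U.
  move=> gk; apply/negPn/negP => kU; have [r /gU] := inU g k extg kU gk.
  by move=> /[swap] ->; rewrite eqxx.
have iU : i \in U by apply: Ug; rewrite gi gt_eqF.
have out k : k \notin U -> F u i <= F v k /\ g k = 0.
  move=> Uk; have gk : g k = 0 by apply/eqP; apply: contraNT Uk => /Ug.
  have ki : k != i by apply: contraNneq Uk => ->.
  split=> //; rewrite -(full_cost_agree s G_gt0 uv ki).
  exact: (idle_full_cost G_gt0 y_gt0 opg).
have [a ga gx] := residual_unit G_gt0 y_gt0 extg xG.
have hx k : h k = x -> k = j.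
  by have [b _ hx] := residual_unit G_gt0 y_gt0 exth xG; rewrite (hx j hj) => /hx.
have ai : a != i.
  by apply/eqP => ai; have := xG; rewrite -ga ai gi ltxx.
have aU : a \in U by apply: Ug; rewrite ga gt_eqF.
have ua : u a = v a by apply: uv.
have wa : a != j -> w a = v a by exact: wv.
(* [j] outside [U] is impossible: it is idle in [g], and exchanges in [g] and [h] involving [a]
   would force [w j <= v j]. *)
have [jU|jU] := boolP (j \in U); last first.
  have [_ gj] := out j jU.
  have aj : a != j by apply: contraNneq jU => <-.
  have ij' : j != i by rewrite eq_sym.
  have := swap_le G_gt0 y_gt0 opg aj.
  rewrite ga gj !cost0 !cx ua (uv ij') addr0 add0r => da_dj.
  have [ha|/hx aj'|ha] := extremal_val a exth; last 1 first.
  - have [r rU hr] : exists2 r, r \in U & h r = 0.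
      by apply: (inU h j) => //; rewrite hj gt_eqF.
    have ra : r != a by apply/eqP => ra; move: G_gt0; rewrite -ha -ra hr ltxx.
    have rj : r != j by apply: contraNneq jU => <-.
    have gr : g r = G.
      have := gU r rU; have [->|/gx|//] := extremal_val r extg.
        by rewrite eqxx.
      by move/eqP; rewrite (negPf ra).
    have ja : j != a by rewrite eq_sym.
    have jr : j != r by rewrite eq_sym.
    have := cycle_le G_gt0 y_gt0 oph jr ja ra.
    have := cycle_le G_gt0 y_gt0 opg rj ra ja.
    rewrite hr ha hj gr ga gj !cost0 !cx !cG (wa aj) (wv rj) ua (uv ij').
    have : v r * G <= u r * G.
      by rewrite ler_wpM2r ?(ltW G_gt0) ?(agree_mono _ uv vu).
    by move: wx_gt; lra.
  - have := swap_le G_gt0 y_gt0 oph aj.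
    rewrite ha hj !cost0 !cx (wa aj); move: wx_gt da_dj; lra.
  - by move: aj; rewrite aj' eqxx.
have va_wj : (G - x) * v a <= (G - x) * w j.
  have [->|aj] := eqVneq a j.
    by rewrite ler_wpM2l ?subr_ge0 ?(ltW vw).
  have [ha|/hx aj'|ha] := extremal_val a exth.
  - have [k kU hk] := outU h a exth aU ha.
    have kj : k != j by apply: contraNneq kU => ->.
    have hkG : h k = G.
      move: hk; have [->|/hx|//] := extremal_val k exth.
        by rewrite eqxx.
      by move/eqP; rewrite (negPf kj).
    have := idle_full_cost G_gt0 y_gt0 oph ha hkG.
    rewrite (full_cost_agree s G_gt0 wv kj) => le1.
    by move: aU lt_F (out k kU).1; rewrite inE; lra.
  - by move: aj; rewrite aj' eqxx.
  - have := swap_le G_gt0 y_gt0 oph aj.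
    rewrite ha hj !cx !cG (wa aj); lra.
(* In [g], let [i] stop, [r] supply [x] and [a] go up to [G]; [va_wj] replaces the variable cost of
   [a] by [w j]. The bound will keep [r] from undercutting [j] at output [x]. *)
have dr r : r \notin U -> F u i - (G - x) * w j <= s r + v r * x.
  move=> rU; have [_ gr] := out r rU.
  have ri : r != i by apply: contraNneq rU => ->.
  have ra : r != a by apply: contraNneq rU => ->.
  have ir : i != r by rewrite eq_sym.
  have ia : i != a by rewrite eq_sym.
  have := cycle_le G_gt0 y_gt0 opg ir ia ra.
  rewrite gi gr ga !cost0 !cx !cG ua (uv ri) FE; move: va_wj; lra.
(* [j] raises its report to the full cost bid by [i] alone. *)
pose b := (F u i - s j) / G.
have bG : s j + b * G = F u i by rewrite divfK ?gt_eqF //; lra.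
have wj_b : w j < b.
  rewrite -(ltr_pM2r G_gt0); move: jU bG lt_F; rewrite inE !FE; lra.
pose z := rebid v j b.
have zv : agree_off j z by move=> k kj; rewrite /z rebid_other.
have zj : z j = b by rewrite /z rebid_same.
have Fzj : F z j = F u i by rewrite [LHS]FE zj bG.
(* Bids below [F u i] under [z] come from [U] without [j], hence from fewer than [m] generators. *)
have price_z : F u i <= price z.
  apply: price_ge => //; apply: (card_lt_units G_gt0 y_gt0 (g := g) (i := j)) => //.
    exact: gU.
  move=> k; rewrite inE => Fk.
  have kj : k != j by apply: contraTneq Fk => ->; rewrite Fzj ltxx.
  split=> //; apply: gU; apply: contraLR Fk => /out[le_F _].
  by rewrite (full_cost_agree s G_gt0 zv kj) -leNgt.
suff [e ope ej] : exists2 e, op z e & e j != 0.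
  apply: (attainable_one_report ij zv ope); rewrite zj.
  have := pos_part_ge (price z - F v i).
  have : (b - v j) * x <= (b - v j) * e j.
    by rewrite ler_wpM2l ?subr_ge0 ?(extremal_gt0 G_gt0 y_gt0 ope.2) ?ltW ?(lt_trans vw).
  have : w j * x < b * x by rewrite ltr_pM2r.
  by move: price_z le_p le_q; rewrite gi hj !FE; lra.
have [e ope] := operator_dispatch_exists G_gt0 y_gt0 s_ge0 z m_lt.
(* An optimum with [j] idle runs some [r] outside [U]; handing its output to [j] costs no more, by
   [dr] at [x] and by [out] at [G]. *)
have [ej|] := eqVneq (e j) 0; last by exists e.
have [r rU er] := outU e j ope.2 jU ej.
have rj : r != j by apply: contraNneq rU => ->.
exists (e \o tperm r j); last by rewrite /= tpermR.
apply: (operator_dispatch_le G_gt0 y_gt0 s_ge0 ope).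
  exact: extremal_comp_perm ope.2.
rewrite total_cost_swap // ej !cost0 zj (zv _ rj).
suff : cost (s j) b (e r) <= cost (s r) (v r) (e r) by lra.
move: er; have [->|->|->] := extremal_val r ope.2; first by rewrite eqxx.
  move=> _; rewrite !cx; have := dr r rU.
  have : (G - x) * w j <= (G - x) * b by rewrite ler_wpM2l ?subr_ge0 // ltW.
  by rewrite -bG; lra.
by move=> _; rewrite !cG bG -FE; apply: (out r rU).1.
Qed.

(** By exchange, each raised bid at [x] would be at most the other generator's true cost at [x], and
    both raises are strict. *)
Lemma residual_not_both_idle : g i = x -> h j = x -> ~ (g j = 0 /\ h i = 0).
Proof.
move=> gi hj [gj hi]; have := swap_le G_gt0 y_gt0 oph ij.
have := swap_le G_gt0 y_gt0 opg ij.
rewrite gi gj hi hj !cost0 !cx (wv ij) (uv (_ : j != i)) 1?eq_sym //.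
by move: ux_gt wx_gt; lra.
Qed.

Lemma attainable_residual_at_capacity : g i = x -> h j = x -> h i = G ->
  s i + u i * x <= s j + w j * x -> attainable i j (p + q).
Proof.
move=> gi hj hi le_ij; apply: (attainable_one_report ij wv oph).
(* This level is [F v i + (u i - v i) * x], so the uplift of the truthful [i] matches its lone gain.
   Neither [j] nor an idle generator bids below it. *)
have : s i + u i * x + (G - x) * v i <= price w.
  apply: price_ge => //; apply: (card_lt_units G_gt0 y_gt0 (g := h) (i := j)) => //.
    by rewrite hj gt_eqF.
  have := swap_le G_gt0 y_gt0 oph ij.
  rewrite hi hj !cx !cG (wv ij) => swap_ij k; rewrite inE => Fk.
  have kj : k != j by apply: contraTneq Fk => ->; rewrite FE -leNgt; lra.
  split=> //; apply: contraTneq Fk => hk; rewrite -leNgt FE.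
  have ki : k != i by apply/eqP => ki; move: G_gt0; rewrite -hi -ki hk ltxx.
  have jk : j != k by rewrite eq_sym.
  have ji : j != i by rewrite eq_sym.
  have := cycle_le G_gt0 y_gt0 oph jk ji ki.
  rewrite hi hj hk !cost0 !cx !cG (wv ij); lra.
have := pos_part_ge (price w - F v i).
by move: le_p le_q; rewrite gi hj !FE; lra.
Qed.

(** With a high enough report [i] stays idle, so that [j] can bid for the
    residual demand as much as [i] alone would. *)
Lemma attainable_withdraw : g i = x -> g j = G -> h j = x -> h i = 0 ->
  attainable i j (p + q).
Proof.
move=> gi gj hj hi.
have ji : j != i by rewrite eq_sym.
have := swap_le G_gt0 y_gt0 oph ij.
rewrite hi hj !cost0 !cx (wv ij) addr0 add0r => le_ji.
(* At [x], [j] now bids what [i] bid alone; by [le_ji] the margin [(b - v j) * x] is at least both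
   lone margins together. *)
pose b := (s i + u i * x - s j) / x.
have bx : b * x = s i + u i * x - s j by rewrite divfK ?gt_eqF.
have [c [e [ope ei]]] := withdraw_exists i (rebid v j b).
set z := rebid _ i c in ope.
have zi : z i = c by rewrite /z rebid_same.
have zj : z j = b by rewrite /z rebid_other // rebid_same.
have zv k : k != i -> k != j -> z k = v k.
  by move=> ki kj; rewrite /z !rebid_other.
suff [f [opf fi fj]] : exists f, [/\ op z f, f i = 0 & f j != 0].
  exists z, f; split=> //.
    by move=> k; rewrite !inE negb_or => /andP[]; apply: zv.
  rewrite !profitE fi mulr0 zj.
  have := pos_part_ge0 (price z - F z i).
  have := pos_part_ge0 (price z - F z j).
  have : (b - v j) * x <= (b - v j) * f j.
    have : 0 < (b - v j) * x by move: bx le_ji ux_gt wx_gt; lra.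
    rewrite pmulr_lgt0 // => bv.
    by rewrite ler_wpM2l ?(ltW bv) ?(extremal_gt0 G_gt0 y_gt0 opf.2).
  by move: bx le_ji ux_gt wx_gt le_p le_q; rewrite gi hj; lra.
have [ej|] := eqVneq (e j) 0; last by exists e.
(* Both dispatches have [m - 1] generators at [G], and [j] is at [G] only in [g], so some [r] is at
   [G] only in [e]. *)
have [r er gr] : exists2 r, e r = G & g r != G.
  case: (pickP [pred r | (e r == G) && (g r != G)]) => [r|none].
    by move=> /andP[/eqP ? ?]; exists r.
  have /eqP eqG : [set k | e k == G] == [set k | g k == G].
    rewrite eqEcard (card_at_capacity G_gt0 extg) //.
    rewrite (card_at_capacity G_gt0 ope.2) // leqnn andbT.
    apply/fintype.subsetP => l; rewrite !inE => el; apply/negPn/negP => gl.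
    by have := none l; rewrite /= el gl.
  have : j \in [set k | e k == G] by rewrite eqG inE gj.
  by rewrite inE ej lt_eqF.
have ri : r != i by apply: contra_eq_neq er => ->; rewrite ei lt_eqF.
have rj : r != j by apply: contra_eq_neq er => ->; rewrite ej lt_eqF.
have gr0 : g r = 0.
  have [//|grx|grG] := extremal_val r extg; last by move: gr; rewrite grG eqxx.
  have [a _ gx] := residual_unit G_gt0 y_gt0 extg xG.
  by move: ri; rewrite (gx r grx) (gx i gi) eqxx.
have ir : i != r by rewrite eq_sym.
(* From [g], [i] stops, [r] takes [G] and [j] takes [x]. If this cost more than [e], then by the
   choice of [b] exchanging [r] and [j] in [e] would undercut [g] under [u]. *)
exists (g \o tperm i r \o tperm r j); split; last 2 first.
- by rewrite /= (@tpermD _ r j i) // tpermL.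
- by rewrite /= !tpermR gi gt_eqF.
apply: (operator_dispatch_le G_gt0 y_gt0 s_ge0 ope).
  by do 2!apply: extremal_comp_perm.
have := operator_dispatch_min G_gt0 y_gt0 opg (extremal_comp_perm (tperm r j) ope.2).
rewrite total_cost_swap // total_cost_cycle // !total_cost_rebidE.
rewrite !(total_cost_rebid s _ uv) rebid_other //.
rewrite ei ej er gi gj gr0 !cost0 zi zj (zv _ ri rj) !cx !cG (uv ri) (uv ji).
move: bx; lra.
Qed.

End TwoRaised.

Lemma attainable_le i j t t' : t <= t' -> attainable i j t' -> attainable i j t.
Proof.
move=> le_t [w [g [wv opt le_t']]].
by exists w, g; split=> //; apply: le_trans le_t le_t'.
Qed.

Lemma attainable_raised i j p q u g w h : i != j ->
  raised i p u g -> raised j q w h -> attainable i j (p + q).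
Proof.
move=> ij ri rj; have ji : j != i by rewrite eq_sym.
have [[_ _ opg gi _] [_ _ oph hj _]] := (ri, rj).
have sym : attainable j i (q + p) -> attainable i j (p + q).
  by rewrite addrC; apply: attainable_sym.
(* When [x = G], an output [x] counts as full capacity, so the residual cases may assume [x < G]. *)
have values f k : op w f \/ op u f -> 0 < f k ->
    f k = G \/ (f k = x /\ x < G).
  move=> opf; have extf : extremal_dispatch G y f by case: opf => -[].
  have [->|->|->] := extremal_val k extf; [by rewrite ltxx| |by left].
  by move: x_le; rewrite le_eqVlt => /orP[/eqP->|]; [left|right].
have [giG|[gix xG]] := values g i (or_intror opg) gi;
  have [hjG|[hjx xG']] := values h j (or_introl oph) hj.
- have [le_F|/ltW le_F] := leP (F u i) (F w j).
    exact: (attainable_capacity ij ri rj).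
  by apply: sym; apply: (attainable_capacity ji rj ri).
- exact: (attainable_capacity_residual ij ri rj).
- by apply: sym; apply: (attainable_capacity_residual ji rj ri).
- have [a _ gx] := residual_unit G_gt0 y_gt0 opg.2 xG.
  have [b _ hx] := residual_unit G_gt0 y_gt0 oph.2 xG.
  have [gj|gj|gj] := extremal_val j opg.2;
    have [hi|hi|hi] := extremal_val i oph.2;
    try by move: ij; rewrite 1?(gx _ gix) 1?(gx _ gj) eqxx.
  all: try by move: ij; rewrite (hx _ hjx) (hx _ hi) eqxx.
  + by case: (residual_not_both_idle ij ri rj gix hjx).
  + by apply: sym; apply: (attainable_withdraw ji rj ri).
  + exact: (attainable_withdraw ij ri rj).
  + have [le_d|/ltW le_d] := leP (s i + u i * x) (s j + w j * x).
      exact: (attainable_residual_at_capacity ij ri rj).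
    by apply: sym; apply: (attainable_residual_at_capacity ji rj ri).
Qed.

Lemma attainable_profits i j u g w h : i != j ->
  agree_off i u -> op u g -> agree_off j w -> op w h ->
  attainable i j (profit u g i + profit w h j).
Proof.
move=> ij uv opg wv oph; have ji : j != i by rewrite eq_sym.
have [le_i|[u' [g' ri]]] := single_cases G_gt0 y_gt0 s_ge0 m_lt uv opg;
  have [le_j|[w' [h' rj]]] := single_cases G_gt0 y_gt0 s_ge0 m_lt wv oph.
- by apply: attainable_le (attainable_truthful ij); apply: lerD.
- by apply: attainable_le (attainable_one_raised ij rj); rewrite lerD2r.
- apply: attainable_sym; apply: attainable_le (attainable_one_raised ji ri).
  by rewrite addrC lerD2r.
- exact: attainable_raised ij ri rj.
Qed.

End Coalition.

(** * Suprema in the extended reals, and supermodularity *)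

Lemma ereal_supD_le (R : realType) (A B C : set (\bar R)) :
  (forall a, A a -> a \is a fin_num) -> (forall b, B b -> b \is a fin_num) ->
  (B !=set0)%classic -> (forall a b, A a -> B b -> (a + b <= ereal_sup C)%E) ->
  (ereal_sup A + ereal_sup B <= ereal_sup C)%E.
Proof.
move=> finA finB [b0 Bb0] leC.
have leA b : B b -> (ereal_sup A <= ereal_sup C - b)%E.
  move=> Bb; apply: ge_ereal_sup => a Aa.
  by rewrite leeBrDr ?finB // leC.
(* [-oo] absorbs any summand; if [ereal_sup A] is [+oo], the single element [b0] already forces
   [ereal_sup C] to be [+oo]. *)
case supA : (ereal_sup A) => [r| |]; last by rewrite addNye leNye.
  rewrite addeC -leeBrDr //; apply: ge_ereal_sup => b Bb.
  rewrite leeBrDr // addeC -leeBrDr ?finB //.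
  by rewrite -supA leA.
have := leA b0 Bb0; rewrite supA leye_eq => /eqP supC.
suff -> : ereal_sup C = +oo%E by rewrite leey.
have := finB b0 Bb0; move: supC.
by case: (ereal_sup C) => [?||] //; case: b0 {Bb0} => [?||].
Qed.

Unset Implicit Arguments.

Theorem theorem2 (R : realType) (n : nat) (G y : R) (s v : 'I_n -> R)
  (G_gt0 : 0 < G)
  (s_ge0 : forall k : 'I_n, 0 <= s k)
  (labelled : forall k l : 'I_n, (k <= l)%N ->
     cost (s k) (v k) G <= cost (s l) (v l) G)
  (y_gt0 : 0 < y)
  (y_le : y <= (n%:R - 2) * G) :
  forall i j : 'I_n, i != j ->
    (market_power G y s v [set i; j]%SET >=
       market_power G y s v [set i]%SET + market_power G y s v [set j]%SET)%E.
Proof.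
move=> i j ij.
(* A positive residual means [(m - 1) * G < y], while [y <= (n - 2) * G]. *)
have m_lt : (num_units G y < n)%N.
  have := residual_gt0 G_gt0 y_gt0; rewrite /residual => x_gt0.
  rewrite -(ltr_nat R) -(ltr_pM2r G_gt0); lra.
pose A S := coalition_profits G y s v S.
have A1 k p : A [set k]%SET p -> exists w g, [/\ agree_off v k w,
    operator_dispatch G y s w g & p = (strategic_profit G y s v w g k)%:E].
  move=> [w [g [wv opt ->]]]; exists w, g; split=> //; last by rewrite big_set1.
  by move=> l lk; apply: wv; rewrite inE.
have finA S p : A S p -> p \is a fin_num by move=> [w [g [_ _ ->]]].
have supD : (ereal_sup (A [set i]%SET) + ereal_sup (A [set j]%SET) <=
    ereal_sup (A [set i; j]%SET))%E.
  apply: ereal_supD_le; [exact: finA|exact: finA| |].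
    have [g opt] := operator_dispatch_exists G_gt0 y_gt0 s_ge0 v m_lt.
    by eexists; exists v, g; split.
  move=> p q /A1[u [g [uv opg ->]]] /A1[w [h [wv oph ->]]].
  have [z [f [zv opf le_f]]] :=
    attainable_profits G_gt0 y_gt0 s_ge0 m_lt ij uv opg wv oph.
  apply: le_ereal_sup_tmp; eexists; first by exists z, f; split.
  by rewrite big_setU1 ?big_set1 ?inE //= -EFinD lee_fin.
(* The truthful profits of [i] and [j] add up to that of the coalition, so both sides subtract the
   same real number. *)
rewrite /market_power addeACA -EFinN -EFinN -EFinD -opprD.
rewrite (big_setU1 i) ?inE //= !big_set1.
by rewrite leeD2r.
Qed.
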